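(* Let $B$ be a complete boolean algebra, and let $\mathcal{TNO}(B)$ be the poset of tense necessity operators on $B$. The following are equivalent: (1) $B$ is atomic. (2) $\mathcal{TNO}(B)$ is a complete atomic boolean algebra. (3) $\mathcal{TNO}(B)$ is a spatial frame.
   Context: A possibility operator on a boolean algebra $B$ is a function $B\to B$ preserving finite joins (including the empty one). Two possibility operators $\Diamond_F,\Diamond_P$ on $B$ are conjugate if for all $a,b\in B$: $\Diamond_F a\wedge b=0\iff\Diamond_P b\wedge a=0$. A possibility operator $\Diamond_F$ is a tense possibility operator if it has a conjugate; in this case $\Box_F=\neg\Diamond_F\neg$ is called a tense necessity operator. $\mathcal{TNO}(B)$ is the set of tense necessity operators on $B$, ordered pointwise: $f\le g$ iff $f(a)\le g(a)$ for all $a\in B$. A frame is a complete lattice $L$ satisfying $a\wedge\bigvee S=\bigvee\{a\wedge b\mid b\in S\}$ for all $a\in L$, $S\subseteq L$. A frame is spatial if it is isomorphic to the frame of open sets of a topological space. *)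

(* Defs.v *)
From HB Require Import structures.
From mathcomp Require Import all_boot all_order.
From mathcomp Require Import boolp classical_sets topology_structure.

Set Implicit Arguments.
Unset Strict Implicit.
Unset Printing Implicit Defensive.

Import Order.Theory.
Local Open Scope classical_set_scope.
Local Open Scope order_scope.

(* Subsets of a poset, seen as types (set_type A unfolds to a sig), carry the
   induced order.  Functions are ordered pointwise in boolp, and sets by
   inclusion in classical_sets. *)
HB.instance Definition _ (d : Order.disp_t) (T : porderType d) (P : pred T) :=
  [SubChoice_isSubPOrder of {x : T | P x} by <: with d].

Definition order_isomorphic (d d' : Order.disp_t)
    (P : porderType d) (Q : porderType d') : Prop :=
  exists f : P -> Q, bijective f /\ {mono f : x y / x <= y}.

Definition complete (d : Order.disp_t) (P : porderType d) : Prop :=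
  forall S : set P, supremums S !=set0 /\ infimums S !=set0.

Definition atom (d : Order.disp_t) (P : bPOrderType d) (a : P) : Prop :=
  a <> \bot /\ forall x : P, x <= a -> x = \bot \/ x = a.

Definition atomic (d : Order.disp_t) (P : bPOrderType d) : Prop :=
  forall x : P, x <> \bot -> exists a : P, atom a /\ a <= x.

Definition frame (d : Order.disp_t) (L : latticeType d) : Prop :=
  complete L /\
  forall (a : L) (S : set L) (s : L), supremums S s ->
    supremums [set a `&` b | b in S]%O (a `&` s).

(* Being a boolean algebra or a frame is a property of the order alone, so a
   poset has it when it is order isomorphic to such a structure. *)
Definition is_complete_atomic_boolean_algebra
    (d : Order.disp_t) (P : porderType d) : Prop :=
  exists (d' : Order.disp_t) (A : ctbDistrLatticeType d'),
    order_isomorphic P A /\ complete A /\ atomic A.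

Definition is_frame (d : Order.disp_t) (P : porderType d) : Prop :=
  exists (d' : Order.disp_t) (L : latticeType d'),
    order_isomorphic P L /\ frame L.

(* Order isomorphisms between frames are exactly the frame isomorphisms. *)
Definition spatial (d : Order.disp_t) (P : porderType d) : Prop :=
  exists X : topologicalType, order_isomorphic P (set_type (@open X)).

Definition is_spatial_frame (d : Order.disp_t) (P : porderType d) : Prop :=
  is_frame P /\ spatial P.

Section TenseOperators.
Context (d : Order.disp_t) (B : ctbDistrLatticeType d).
Implicit Types F P g : B -> B.

Definition possibility F : Prop :=
  forall s : seq B, F (\join_(x <- s) x) = \join_(x <- s) F x.

Definition conjugate F P : Prop :=
  forall a b : B, F a `&` b = \bot <-> P b `&` a = \bot.

Definition tense_possibility F : Prop :=
  possibility F /\ exists P, possibility P /\ conjugate F P.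

Definition dual_operator F : B -> B := fun a => ~` F (~` a).

Definition tense_necessity g : Prop :=
  exists F, tense_possibility F /\ g = dual_operator F.

Definition TNO := set_type [set g : B -> B | tense_necessity g].

HB.instance Definition _ := Order.SubPOrder.on TNO.

End TenseOperators.

(* Main.v *)
(** A map is a tense necessity operator exactly when it has a lower adjoint.
    When [B] is atomic, such a map [g] is determined by the binary relation
    [p <= g (~` q)] between atoms, and every relation arises, so [TNO B] is a
    powerset; powersets are the open sets of discrete spaces.  Conversely,
    sending [b] to the map with value [b] off [\top] embeds [B] in [TNO B] and
    keeps suprema and disjointness, so a point of [TNO B] in the image of
    [b <> \bot] restricts to a completely prime filter of [B] containing [b];
    in a boolean algebra such a filter is generated by an atom below [b]. *)
Require Import Defs.
From mathcomp Require Import all_boot all_order.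
From mathcomp Require Import boolp classical_sets topology_structure.
From mathcomp Require Import discrete_topology.

Set Implicit Arguments.
Unset Strict Implicit.
Unset Printing Implicit Defensive.

Import Order.Theory.
Local Open Scope classical_set_scope.
Local Open Scope order_scope.

(** * Composing and recognising order isomorphisms *)

Section OrderIsomorphisms.
Context (d d' d'' : Order.disp_t).
Context (P : porderType d) (Q : porderType d') (R : porderType d'').

Lemma mono_surj_order_isomorphic (f : P -> Q) :
  {mono f : x y / x <= y} -> (forall y, exists x, f x = y) ->
  order_isomorphic P Q.
Proof.
move=> f_mono /choice[g fgK]; exists f; split => //.
by exists g => // x; apply: (inc_inj f_mono).
Qed.

Lemma order_isomorphic_trans :
  order_isomorphic P Q -> order_isomorphic Q R -> order_isomorphic P R.
Proof.
move=> [f [f_bij f_mono]] [g [g_bij g_mono]]; exists (g \o f).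
by split=> [|x y /=]; [exact: bij_comp | rewrite g_mono f_mono].
Qed.

End OrderIsomorphisms.

(** * Atoms, frames and spatiality in boolean algebras *)

Section Atoms.
Context (d : Order.disp_t) (A : ctbDistrLatticeType d).
Implicit Types (p q x y s : A) (X : set A).

Lemma disjP x y : x `&` y = \bot <-> x <= ~` y.
Proof. by rewrite -disj_leC; split=> [->|/eqP]. Qed.

Lemma atom_leC p x : atom p -> (p <= ~` x) = ~~ (p <= x).
Proof.
move=> [p0 p_min]; apply/idP/idP => [pCx|pNx].
  apply/negP => px; apply: p0; apply/eqP; rewrite -lex0.
  by rewrite -(meetxC x) lexI px.
have [px0|pxp] := p_min (p `&` x) (leIl _ _); first exact/disjP.
by rewrite -pxp leIr in pNx.
Qed.

Lemma atom_le_eq p q : atom p -> atom q -> p <= q -> p = q.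
Proof. by move=> [p0 _] [_ q_min] /q_min[]. Qed.

(** If [p] lies below no member of [X], then the complement of [p] bounds [X] and hence [s], which
    contradicts [p <= s]. So atoms are completely prime. *)
Lemma atom_le_sup p X s :
  atom p -> supremums X s -> p <= s -> exists2 x, X x & p <= x.
Proof.
move=> p_atom [_ s_least] ps; apply: contrapT => noX.
suff : s <= ~` p.
  by move/(le_trans ps); rewrite atom_leC // lexx.
apply: s_least => x Xx; rewrite lexC atom_leC //.
by apply/negP => px; apply: noX; exists x.
Qed.

(** When [x] is not below [y], an atom under the meet of [x] with the complement of [y] separates
    them. *)
Lemma atomic_le x y :
  atomic A -> (forall p, atom p -> p <= x -> p <= y) -> x <= y.
Proof.
move=> A_atomic xy; apply: contrapT => xNy.
have xCy0 : x `&` ~` y <> \bot by move/disjP; rewrite complK.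
have [p [p_atom]] := A_atomic _ xCy0.
by rewrite lexI => /andP[/(xy _ p_atom) py]; rewrite atom_leC // py.
Qed.

(** Meeting with [a] is lower adjoint to joining with the complement of [a], so it preserves
    suprema. *)
Lemma complete_ctb_frame : complete A -> frame A.
Proof.
move=> A_complete; split=> // a S s [s_ub s_least]; split.
  by move=> _ [b /s_ub bs <-]; rewrite leI2.
move=> c c_ub; suff /(leI2 (lexx a)) : s <= ~` a `|` c.
  by move/le_trans; apply; rewrite meetUr meetxC join0x leIr.
apply: s_least => b Sb; have : a `&` b <= c by apply: c_ub; exists b.
move/(leU2 (lexx (~` a))); apply: le_trans.
by rewrite joinIr joinCx meet1x leUr.
Qed.

(** Each [x] is sent to the set of atoms below it, open in the discrete topology. Atomicity makes
    this an order embedding; complete primeness of atoms makes it onto. *)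
Lemma complete_atomic_spatial : complete A -> atomic A -> spatial A.
Proof.
move=> A_complete A_atomic.
pose At := discrete_topology (set_type [set p : A | atom p]).
have at_open (U : set At) : U \in @open At.
  by apply/mem_set; exact: discrete_open.
exists At.
pose f x : set_type (@open At) := exist _ [set p | val p <= x] (at_open _).
apply: (@mono_surj_order_isomorphic _ _ _ _ f) => [x y|[U U_open]].
  apply/idP/idP => [/subsetPset fxy|xy].
    apply: atomic_le => // p p_atom px.
    exact: (fxy (exist _ p (mem_set p_atom))).
  by apply/subsetPset => p /= px; exact: le_trans xy.
have [[s sup_s] _] := A_complete [set p | exists2 u : At, U u & p = val u].
exists s; apply: val_inj; apply/seteqP; split=> [p /= ps|p Up]; last first.
  by apply: sup_s.1; exists p.
have p_atom := set_mem (valP p).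
have [_ [u Uu ->] pu] := atom_le_sup p_atom sup_s ps.
by have /val_inj -> := atom_le_eq p_atom (set_mem (valP u)) pu.
Qed.

End Atoms.

(** * Powersets are complete and atomic *)

Lemma complete_set (T : Type) : complete (set T).
Proof.
move=> S; split.
  exists (\bigcup_(U in S) U); split=> [U SU|V V_ub]; apply/subsetPset.
    exact: bigcup_sup.
  by apply: bigcup_sub => U SU; apply/subsetPset; exact: V_ub.
exists (\bigcap_(U in S) U); split=> [U SU|V V_lb]; apply/subsetPset.
  exact: bigcap_inf.
by apply: sub_bigcap => U SU; apply/subsetPset; exact: V_lb.
Qed.

Lemma atomic_set (T : Type) : atomic (set T).
Proof.
move=> U /eqP/set0P[t Ut]; exists [set t]; split; last first.
  by apply/subsetPset => _ ->.
split=> [t0|V /subsetPset V_sub].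
  by have : [set t] t by []; rewrite t0.
by have /subset_set1[] := V_sub; [left | right].
Qed.

(** * Tense necessity operators as upper adjoints *)

Section TenseNecessity.
Context (d : Order.disp_t) (B : ctbDistrLatticeType d).
Implicit Types (F P g : B -> B) (a b c : B).

(** Conjugacy makes [F] lower adjoint to the dual of [P], and lower adjoints preserve joins. *)
Lemma conjugate_possibility F P : conjugate F P -> possibility F.
Proof.
move=> FP s.
have F_le a b : (F a <= b) = (a <= ~` P (~` b)).
  rewrite -{1}[b]complK [RHS]lexC.
  by apply/idP/idP => /disjP/(FP _ _)/disjP.
apply/eqP; rewrite eq_le F_le; apply/andP; split; apply/joinsP_seq => x xs _.
  by rewrite -F_le; exact: joins_sup_seq.
rewrite F_le; apply: le_trans (_ : \join_(x <- s) x <= _).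
  exact: joins_sup_seq.
by rewrite -F_le.
Qed.

Lemma conjugate_sym F P : conjugate F P -> conjugate P F.
Proof. by move=> FP a b; split=> /FP. Qed.

(** Rewriting disjointness as an inequality with a complement turns conjugacy of [F] and [P] into
    adjointness of [P] and the dual of [F]. *)
Lemma tense_necessityP g :
  tense_necessity g <-> exists P, forall a c, (c <= g a) = (P c <= a).
Proof.
split=> [[F [[_ [P [_ FP]]] ->]]|[P adj]].
  exists P => a c; apply/idP/idP; rewrite /dual_operator lexC.
    by move=> /disjP/FP/disjP; rewrite complK.
  by rewrite -{1}[a]complK => /disjP/FP/disjP.
have gP : conjugate (dual_operator g) P.
  by move=> a b; rewrite !disjP -adj /dual_operator leC.
exists (dual_operator g); split; last first.
  by apply/funext => a; rewrite /dual_operator !complK.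
split; first exact: conjugate_possibility gP.
exists P; split => //; exact: conjugate_possibility (conjugate_sym gP).
Qed.

Lemma TNO_leP (g h : TNO B) : reflect (forall a, val g a <= val h a) (g <= h).
Proof. exact: lefP. Qed.

End TenseNecessity.

(** * Operators on an atomic algebra as relations between atoms *)

Section AtomicTNO.
Context (d : Order.disp_t) (B : ctbDistrLatticeType d).
Hypotheses (B_complete : complete B) (B_atomic : atomic B).
Let At := set_type [set p : B | atom p].

Lemma TNO_powerset : order_isomorphic (TNO B) (set (At * At)).
Proof.
pose f (g : TNO B) : set (At * At) :=
  [set pq | val pq.1 <= val g (~` val pq.2)].
have At_atom (p : At) : atom (val p) := set_mem (valP p).
apply: (@mono_surj_order_isomorphic _ _ _ _ f) => [g h|S].
  apply/idP/idP => [/subsetPset fgh|/TNO_leP gh]; last first.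
    by apply/subsetPset => pq /= /le_trans; apply.
  apply/TNO_leP => a; apply: atomic_le => // p p_atom pga.
  (* The claim becomes [P p <= a]. An atom [q] below [P p] but not below [a] has its complement
     above [a]; monotonicity of [g] and the hypothesis then put [P p], hence [q], below the
     complement of [q]. *)
  have /tense_necessityP[P adj] := set_mem (valP h).
  have /tense_necessityP[Q adjg] := set_mem (valP g).
  rewrite adj; apply: atomic_le => // q q_atom qPp; apply: contrapT => qNa.
  suff : q <= ~` q by rewrite atom_leC // lexx.
  apply: le_trans qPp _; rewrite -adj.
  apply: (fgh (exist _ p (mem_set p_atom), exist _ q (mem_set q_atom))) => /=.
  rewrite /f /= adjg; apply: le_trans (_ : a <= _); first by rewrite -adjg.
  by rewrite lexC atom_leC //; exact/negP.
pose sup (X : set B) : B := projT1 (cid (B_complete X).1).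
have supP X : supremums X (sup X) := projT2 (cid (B_complete X).1).
(* The accessibility relation of the operator [g] is the complement of [S]. *)
pose g a := sup [set val p | p in [set p : At |
  forall q : At, ~ S (p, q) -> val q <= a]].
(* The lower adjoint of [g]: the join of all successors of atoms below [c]. *)
pose P c := sup [set val q | q in [set q : At |
  exists2 p : At, val p <= c & ~ S (p, q)]].
(* An atom below a supremum of atoms is one of them, so [g a] has no atoms beyond those joined. *)
have g_atom (p : At) a :
    val p <= g a <-> forall q : At, ~ S (p, q) -> val q <= a.
  split=> [|pa]; last by apply: (supP _).1; exists p.
  move=> /(atom_le_sup (At_atom p) (supP _))[_ [r ra <-]].
  by move=> /(atom_le_eq (At_atom p) (At_atom r))/val_inj->.
have g_TNO : tense_necessity g.
  apply/tense_necessityP; exists P => a c; apply/idP/idP => [cga|Pca].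
    apply: (supP _).2 => _ [q [p pc nS] <-].
    by have /g_atom := le_trans pc cga; apply.
  apply: atomic_le => // p p_atom pc.
  apply/(g_atom (exist _ p (mem_set p_atom))) => q nS.
  apply: le_trans Pca; apply: (supP _).1; exists q => //.
  by exists (exist _ p (mem_set p_atom)).
exists (exist _ g (mem_set g_TNO)); apply/seteqP; split=> -[p q] /=.
  move=> /g_atom gpq; apply: contrapT => /gpq.
  by rewrite atom_leC // lexx.
move=> Spq; apply/g_atom => r nS; rewrite atom_leC //.
apply/negP => /(atom_le_eq (At_atom r) (At_atom q))/val_inj rq.
by rewrite rq in nS.
Qed.

End AtomicTNO.

(** * From points of [TNO B] to atoms of [B] *)

Section SpatialTNO.
Context (d : Order.disp_t) (B : ctbDistrLatticeType d).
Hypothesis B_complete : complete B.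
Implicit Types (a b c : B).

(** The exception at [\top] is forced: a map with a lower adjoint fixes [\top]. *)
Definition const_necessity b a : B := if a == \top then \top else b.

Lemma const_necessityP b : tense_necessity (const_necessity b).
Proof.
apply/tense_necessityP.
(* The adjoint picks the least argument whose value is above [c]: [\bot] already works if [c <= b],
   and otherwise only [\top] does. *)
exists (fun c => if c <= b then \bot else \top) => a c.
rewrite /const_necessity; case: ifP => [/eqP->|a1]; first by rewrite !lex1.
by case: ifP => _; rewrite ?le0x // le1x a1.
Qed.

Definition const_TNO b : TNO B :=
  exist _ (const_necessity b) (mem_set (const_necessityP b)).

Lemma const_TNO_least (h : TNO B) c :
  (forall a, a != \top -> c <= val h a) -> const_TNO c <= h.
Proof.
move=> ch; apply/TNO_leP => a /=; rewrite /const_necessity.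
case: ifP => [/eqP->|/negbT/ch//].
have /tense_necessityP[P adj] := set_mem (valP h).
by rewrite adj lex1.
Qed.

Lemma spatial_TNO_atomic : spatial (TNO B) -> atomic B.
Proof.
move=> [X [f [[h fK hK] f_mono]]] b b0.
pose O c : set X := val (f (const_TNO c)).
have top0 : (\bot : B) != \top.
  by apply/eqP => E; apply: b0; apply/eqP; rewrite -lex0 E lex1.
have leP (g g' : TNO B) : g <= g' <-> val (f g) `<=` val (f g').
  by rewrite -f_mono; split=> /subsetPset.
have open_val (U : set X) : open U -> exists g, val (f g) = U.
  by move=> U_open; exists (h (exist _ U (mem_set U_open))); rewrite hK.
have O_open c : open (O c) := set_mem (valP (f (const_TNO c))).
have O_le c c' : c <= c' -> O c `<=` O c'.
  move=> cc'; apply/leP/const_TNO_least => a /negbTE a1 /=.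
  by rewrite /const_necessity a1.
have O_bot x : ~ O \bot x.
  have [g g0] := open_val _ open0.
  suff : O \bot `<=` set0 by apply.
  by rewrite -g0; apply/leP/const_TNO_least => a _; exact: le0x.
have O_disj c x : O c x -> ~ O (~` c) x.
  (* The intersection is open, so it comes from an operator [g]; off [\top] its values lie below
     both [c] and its complement, hence are [\bot]. *)
  have [g gE] := open_val _ (openI (O_open c) (O_open (~` c))).
  move=> Ox OCx; apply: (O_bot x).
  suff : val (f g) `<=` O \bot by apply; rewrite gE.
  have /leP/TNO_leP gc : val (f g) `<=` O c by rewrite gE; exact: subIsetl.
  have /leP/TNO_leP gCc : val (f g) `<=` O (~` c).
    by rewrite gE; exact: subIsetr.
  apply/leP/TNO_leP => a; have := gc a; have := gCc a.
  rewrite /= /const_necessity; case: ifP => // _ gaCc gac.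
  by rewrite -(meetxC c) lexI gac gaCc.
have [x Obx] : O b !=set0.
  apply: contrapT => /set0P/negP/negPn/eqP Ob0.
  (* Evaluating at [\bot], which differs from [\top], recovers [b <= \bot]. *)
  have /leP/TNO_leP/(_ \bot) : O b `<=` O \bot by rewrite Ob0.
  by rewrite /= /const_necessity (negbTE top0) lex0 => /eqP.
have [[s s_sup] _] := B_complete [set c | ~ O c x].
have sNx : ~ O s x.
  move=> Osx.
  (* Let [g] match the union of the [O c] that miss [x]. Off [\top] its values bound every such [c],
     hence [s], so [O s] lies in a union that misses [x]. *)
  have [g gE] := open_val _ (bigcup_open (fun c (_ : ~ O c x) => O_open c)).
  suff : O s `<=` val (f g) by move=> /(_ _ Osx); rewrite gE => -[].
  apply/leP/const_TNO_least => a /negbTE a1.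
  apply: s_sup.2 => c cNx.
  have /leP/TNO_leP/(_ a) : O c `<=` val (f g).
    by rewrite gE => y Ocy; exists c.
  by rewrite /= /const_necessity a1.
(* The complement of [s] bounds from below the filter of all [c] with [x] in [O c]; it is the atom
   sought. *)
have Cs_le c : O c x -> ~` s <= c.
  by move=> Ocx; rewrite leCx; apply: s_sup.1; exact: O_disj.
exists (~` s); split; last exact: Cs_le.
split=> [Cs0|c cCs].
  apply: sNx; apply: O_le Obx.
  by rewrite -[s]complK Cs0 compl0 lex1.
(* Either [c] is in the filter and so above the complement of [s], or it is one of the elements
   joined in [s] and lies below both [s] and its complement. *)
have [/Cs_le sc|cNx] := pselect (O c x).
  by right; apply/eqP; rewrite eq_le cCs sc.
left; apply/eqP; rewrite -lex0 -(meetxC s) lexI cCs andbT.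
exact: s_sup.1.
Qed.

End SpatialTNO.

Theorem corollary4p12 (d : Order.disp_t) (B : ctbDistrLatticeType d)
    (B_complete : complete B) :
  [<-> atomic B;
       is_complete_atomic_boolean_algebra (TNO B);
       is_spatial_frame (TNO B)].
Proof.
tfae=> [B_atomic|[d' [A [TNO_A [A_complete A_atomic]]]]|[_]].
- pose At := set_type [set p : B | atom p].
  exists _, (set (At * At)).
  split; first exact: TNO_powerset.
  by split; [exact: complete_set | exact: atomic_set].
- split; first by exists d', A; split=> //; exact: complete_ctb_frame.
  have [X A_X] := complete_atomic_spatial A_complete A_atomic.
  by exists X; exact: order_isomorphic_trans A_X.
- exact: spatial_TNO_atomic.
Qed.
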